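(* Let $n\ge 4$, and let $\mathcal{R}$ be a family of $n$ positive real radii with $k$ distinct values, where the $i$-th value occurs $m_i\ge 1$ times, arranged as $$r_{(1,1)}=\dots=r_{(1,m_1)}>r_{(2,1)}=\dots=r_{(2,m_2)}>\dots>r_{(k,1)}=\dots=r_{(k,m_k)},\qquad m_1+m_2+\dots+m_k=n.$$ Then there exists a convex configuration of points $\mathcal{V}=\{v_1,\dots,v_n\}$ in $\mathbb{R}^3$ with respect to the radii $\mathcal{R}$ (in the sense defined in the context).
   Context: Fix the origin $O\in\mathbb{R}^3$. The radius of a point $v\in\mathbb{R}^3$ is its Euclidean distance from $O$. A convex polyhedron means the convex hull of a finite set of points of $\mathbb{R}^3$ (equivalently a bounded intersection of finitely many half-spaces), with nonempty interior. Given a family of $n$ positive reals (repetitions allowed), a convex configuration in $\mathbb{R}^3$ with respect to these radii is a choice of $n$ distinct points $v_1,\dots,v_n\in\mathbb{R}^3$, one for each member of the family and at that distance from $O$, such that there is a convex polyhedron (namely the convex hull of $\{v_1,\dots,v_n\}$) containing $O$ of which every $v_i$ is a vertex. *)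

(* Defs.v *)
From HB Require Import structures.
From mathcomp Require Import all_boot all_order all_algebra.
From mathcomp Require Import all_classical all_reals all_analysis.

Set Implicit Arguments.
Unset Strict Implicit.
Unset Printing Implicit Defensive.

Import Order.TTheory GRing.Theory Num.Theory.
Import numFieldNormedType.Exports.

Local Open Scope classical_set_scope.
Local Open Scope ring_scope.

Definition dot (R : realType) (u v : 'rV[R]_3) : R :=
  \sum_(i < 3) u 0 i * v 0 i.

(* The library norm `|v| on row vectors is the maximum norm, not the
   Euclidean one. *)
Definition radius (R : realType) (v : 'rV[R]_3) : R := Num.sqrt (dot v v).

Definition convex_hull (R : realType) (A : set 'rV[R]_3) : set 'rV[R]_3 :=
  smallest (@convex_set R 'rV[R]_3) A.

(* The topology of 'rV[R]_3 is the usual one of R^3. *)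
Definition convex_polyhedron (R : realType) (P : set 'rV[R]_3) : Prop :=
  (exists2 A : set 'rV[R]_3, finite_set A & P = convex_hull A) /\
  interior P !=set0.

(* A vertex is a 0-dimensional face: some supporting plane of P, with outer
   normal c, meets P exactly in v. *)
Definition vertex (R : realType) (P : set 'rV[R]_3) (v : 'rV[R]_3) : Prop :=
  P v /\ exists c : 'rV[R]_3, forall x, P x -> x <> v -> dot c x < dot c v.

Definition convex_configuration (R : realType) (I : finType)
    (r : I -> R) (v : I -> 'rV[R]_3) : Prop :=
  [/\ injective v,
      forall i, radius (v i) = r i
    & exists P : set 'rV[R]_3,
        [/\ P = convex_hull (range v), convex_polyhedron P, P 0
          & forall i, vertex P (v i)]].

(* Main.v *)
(* The points are placed on an ellipsoid
     x^2 + b (y^2 + z^2) - a x - 2 h y - p = 0,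
   so that strict convexity makes each of them a vertex of their hull.  The
   choice a = r1 - r2, p = r1 r2 puts (r1, 0, 0) and (- r2, 0, 0) on it, and the
   segment between these two points contains the origin.  Substituting
   y^2 + z^2 = r^2 - x^2 makes the equation linear in y, hence for each
   prescribed x there is one y, and two opposite z, giving a point of the
   ellipsoid at distance r.  When b and then h are large and x is positive and
   small, y is positive and small, so that z is real and nonzero; distinct
   values of x give distinct points, and reversing the sign of z for one of them
   makes the hull three-dimensional. *)
Require Import Defs.
From HB Require Import structures.
From mathcomp Require Import all_boot all_order all_algebra.
From mathcomp Require Import all_classical all_reals all_analysis.
From mathcomp Require Import ring lra.

Import Order.TTheory GRing.Theory Num.Theory.
Import numFieldNormedType.Exports.

Local Open Scope classical_set_scope.
Local Open Scope ring_scope.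

(** * Convex combinations and convex hulls *)

Lemma convex_setP {R : realType} {M : lmodType R} (A : set M) :
  convex_set A <->
  forall x y s t, A x -> A y -> 0 <= s -> 0 <= t -> s + t = 1 ->
    A (s *: x + t *: y).
Proof.
split=> [cA x y s t Ax Ay s0 t0 st1|cA x y k].
  have s1 : s <= 1 by lra.
  have -> : t = 1 - s by lra.
  by have := cA x y (Itv01 s0 s1) (mem_set Ax) (mem_set Ay); rewrite inE.
rewrite !inE => Ax Ay; apply: (cA x y k%:num (1 - k%:num)) => //; last lra.
Qed.

(** The points are averaged two by two, and the two means are then averaged with weights [wa + wb]
    and [wc + wd], which are nonzero and so cancel the denominators. *)
Lemma convex_set4 {R : realType} {M : lmodType R} (A : set M) (a b c d : M)
    (wa wb wc wd : R) :
  convex_set A -> A a -> A b -> A c -> A d ->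
  0 < wa -> 0 < wb -> 0 < wc -> 0 < wd -> wa + wb + wc + wd = 1 ->
  A (wa *: a + wb *: b + wc *: c + wd *: d).
Proof.
move=> /convex_setP cA Aa Ab Ac Ad a0 b0 c0 d0 w1.
have mean x y s t : A x -> A y -> 0 < s -> 0 < t ->
    A ((s / (s + t)) *: x + (t / (s + t)) *: y).
  move=> Ax Ay s0 t0; have st0 : 0 < s + t by lra.
  apply: cA; rewrite ?divr_ge0 ?(ltW s0) ?(ltW t0) ?(ltW st0)//.
  by rewrite -mulrDl divff ?gt_eqF.
have := cA _ _ (wa + wb) (wc + wd) (mean _ _ _ _ Aa Ab a0 b0)
  (mean _ _ _ _ Ac Ad c0 d0).
rewrite !scalerDr !scalerA !(mulrC (_ + _) (_ / _)) !divfK ?gt_eqF ?addr_gt0//.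
by rewrite !addrA; apply; lra.
Qed.

Lemma convex_hull_sub {R : realType} (A : set 'rV[R]_3) :
  A `<=` convex_hull A.
Proof. exact: sub_gen_smallest. Qed.

Lemma convex_hull_convex {R : realType} (A : set 'rV[R]_3) :
  convex_set (convex_hull A).
Proof.
apply/convex_setP => x y s t hx hy s0 t0 st C [cC AC].
move/convex_setP: (cC); apply=> //.
- exact: hx.
- exact: hy.
Qed.

(** * Coordinates in space and the interior of a tetrahedron *)

Definition vec3 {R : realType} (x y z : R) : 'rV[R]_3 :=
  \row_(i < 3) [:: x; y; z]`_i.

Lemma vec3E {R : realType} (x y z : R) :
  ((vec3 x y z 0 0 = x) * (vec3 x y z 0 1 = y) * (vec3 x y z 0 2%:R = z))%type.
Proof. by rewrite !mxE. Qed.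

Lemma dotE {R : realType} (u v : 'rV[R]_3) :
  dot u v = u 0 0 * v 0 0 + u 0 1 * v 0 1 + u 0 2%:R * v 0 2%:R.
Proof.
rewrite /dot !big_ord_recl big_ord0 addr0 addrA.
by do 2?congr (_ + _); congr (u 0 _ * v 0 _); apply/val_inj.
Qed.

Lemma row3P {R : realType} (u v : 'rV[R]_3) :
  u 0 0 = v 0 0 -> u 0 1 = v 0 1 -> u 0 2%:R = v 0 2%:R -> u = v.
Proof.
move=> e0 e1 e2; apply/rowP => -[[|[|[|//]]] lt3]; [move: e0|move: e1|move: e2];
  by congr (u 0 _ = v 0 _); apply/val_inj.
Qed.

Lemma dot_continuous {R : realType} (c : 'rV[R]_3) : continuous (dot c).
Proof.
have -> : dot c = fun x => c 0 0 * x 0 0 + c 0 1 * x 0 1 + c 0 2%:R * x 0 2%:R.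
  by apply/funext => x; exact: dotE.
have cvg_coord i (x : 'rV[R]_3) : c 0 i * y 0 i @[y --> x] --> c 0 i * x 0 i.
  by apply: cvgMl_tmp; exact: coord_continuous.
move=> x.
exact: (cvgD (cvgD (cvg_coord 0 x) (cvg_coord 1 x)) (cvg_coord 2%:R x)).
Qed.

(** The barycentric coordinates with respect to the four points are affine, hence continuous, and
    all equal 1/4 at the centroid [x0]. They stay positive near [x0], so every point there is a
    convex combination of the four. *)
Lemma interior_tetrahedron {R : realType} (P : set 'rV[R]_3)
    (r1 r2 x3 y3 z3 x4 y4 z4 : R) :
  convex_set P -> 0 < r1 -> 0 < r2 -> y3 * z4 - z3 * y4 != 0 ->
  P (vec3 r1 0 0) -> P (vec3 (- r2) 0 0) ->
  P (vec3 x3 y3 z3) -> P (vec3 x4 y4 z4) ->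
  interior P !=set0.
Proof.
move=> cP r10 r20 D0 P1 P2 P3 P4; pose D := y3 * z4 - z3 * y4.
(* w1, w2, dot c3 and dot c4 are the barycentric coordinates. *)
pose c3 := vec3 0 (z4 / D) (- y4 / D).
pose c4 := vec3 0 (- z3 / D) (y3 / D).
(* [dot c0 x] is what remains of the first coordinate once the third and fourth points have
   contributed. The first two weights solve r1 w1 - r2 w2 = [dot c0 x] and w1 + w2 = 1 - [dot c3 x]
   - [dot c4 x]. *)
pose c0 : 'rV[R]_3 := vec3 1 0 0 - x3 *: c3 - x4 *: c4.
pose S := r1 + r2.
have S0 : r1 + r2 != 0 by rewrite gt_eqF ?addr_gt0.
pose c1 := S^-1 *: (c0 - r2 *: (c3 + c4)).
pose c2 := S^-1 *: (- c0 - r1 *: (c3 + c4)).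
pose w1 x := r2 / S + dot c1 x.
pose w2 x := r1 / S + dot c2 x.
have E3 x : dot c3 x = (z4 * x 0 1 - y4 * x 0 2%:R) / D.
  by rewrite dotE !vec3E; ring.
have E4 x : dot c4 x = (y3 * x 0 2%:R - z3 * x 0 1) / D.
  by rewrite dotE !vec3E; ring.
have E0 x : dot c0 x = x 0 0 - x3 * dot c3 x - x4 * dot c4 x.
  by rewrite /c0; clearbody c3 c4; rewrite !dotE !mxE/=; ring.
have E1 x : w1 x = (dot c0 x + r2 * (1 - dot c3 x - dot c4 x)) / S.
  by rewrite /w1 /c1; clearbody c0 c3 c4; rewrite !dotE !mxE; ring.
have E2 x : w2 x = (r1 * (1 - dot c3 x - dot c4 x) - dot c0 x) / S.
  by rewrite /w2 /c2; clearbody c0 c3 c4; rewrite !dotE !mxE; ring.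
have pos k c x0 : k + dot c x0 = 4^-1 ->
    \forall x \near x0, 0 < k + dot c x.
  move=> kc; have : k + dot c x @[x --> x0] --> k + dot c x0.
    exact: (cvgD (cvg_cst k) (dot_continuous c x0)).
  by move=> /cvgr_gt; apply; rewrite kc invr_gt0 ltr0n.
pose x0 := vec3 ((r1 - r2 + x3 + x4) / 4) ((y3 + y4) / 4) ((z3 + z4) / 4).
have E30 : dot c3 x0 = 4^-1 by rewrite E3 !vec3E /D; field.
have E40 : dot c4 x0 = 4^-1 by rewrite E4 !vec3E /D; field.
have E00 : dot c0 x0 = (r1 - r2) / 4 by rewrite E0 E30 E40 !vec3E; field.
exists x0; rewrite /interior /=.
near=> x.
have [p1 p2 p3 p4] :
    [/\ 0 < w1 x, 0 < w2 x, 0 < 0 + dot c3 x & 0 < 0 + dot c4 x].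
  split; near: x; apply: pos; rewrite ?add0r//.
  - by rewrite -/(w1 x0) E1 E00 E30 E40 /S; field.
  - by rewrite -/(w2 x0) E2 E00 E30 E40 /S; field.
rewrite !add0r in p3 p4.
have := convex_set4 P _ _ _ _ _ _ _ _ cP P1 P2 P3 P4 p1 p2 p3 p4.
have -> : w1 x *: vec3 r1 0 0 + w2 x *: vec3 (- r2) 0 0 +
    dot c3 x *: vec3 x3 y3 z3 + dot c4 x *: vec3 x4 y4 z4 = x.
  apply: row3P; rewrite !mxE/=.
  - by rewrite E1 E2 E0 /S; move: (dot c3 x) (dot c4 x) => u v; field.
  - by rewrite E3 E4 /D; move: (w1 x) (w2 x) => u v; field.
  - by rewrite E3 E4 /D; move: (w1 x) (w2 x) => u v; field.
apply; rewrite E1 E2 /S; move: (dot c0 x) (dot c3 x) (dot c4 x) => t u v.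
by field.
Unshelve. all: by end_near.
Qed.

(** * Strict convexity of the ellipsoid *)

Definition ellipsoid {R : realType} (a h p b : R) (x : 'rV[R]_3) : R :=
  x 0 0 ^+ 2 + b * (x 0 1 ^+ 2 + x 0 2%:R ^+ 2) - a * x 0 0 - 2 * h * x 0 1 - p.

(** With Q the quadratic part of q = [ellipsoid a h p b], s + t = 1 gives q(s x + t y) = s q(x) + t
    q(y) - s t Q(x - y), and Q is nonnegative. *)
Lemma convex_ellipsoid {R : realType} (a h p b : R) : 0 <= b ->
  convex_set [set x | ellipsoid a h p b x <= 0].
Proof.
move=> b0; apply/convex_setP => x y s t /= qx qy s0 t0 st1.
pose d := x - y.
have d0 : 0 <= s * t * (d 0 0 ^+ 2 + b * (d 0 1 ^+ 2 + d 0 2%:R ^+ 2)).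
  by do ?[exact: sqr_ge0|apply: mulr_ge0|apply: addr_ge0].
have -> : ellipsoid a h p b (s *: x + t *: y) =
    s * ellipsoid a h p b x + t * ellipsoid a h p b y -
    s * t * (d 0 0 ^+ 2 + b * (d 0 1 ^+ 2 + d 0 2%:R ^+ 2)).
  have -> : t = 1 - s by lra.
  by rewrite /d /ellipsoid !mxE; ring.
by rewrite subr_le0 (le_trans _ d0)// -oppr_ge0 opprD addr_ge0// oppr_ge0
  mulr_ge0_le0.
Qed.

(** The second-order expansion of q = [ellipsoid a h p b] at v is exact, and its quadratic part is
    positive definite. Hence the gradient at v paired with x - v is less than q(x) - q(v), which is
    at most 0. *)
Lemma ellipsoid_vertex {R : realType} (a h p b : R) (P : set 'rV[R]_3) v :
  0 < b -> (forall x, P x -> ellipsoid a h p b x <= 0) ->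
  P v -> ellipsoid a h p b v = 0 -> vertex P v.
Proof.
move=> b0 Pq Pv qv; split=> //.
(* The outer normal is the gradient of [ellipsoid a h p b] at v. *)
exists (vec3 (2 * v 0 0 - a) (2 * b * v 0 1 - 2 * h) (2 * b * v 0 2%:R)).
move=> x Px xv; rewrite !dotE !vec3E -subr_lt0.
pose d := x - v.
have d0 : 0 < d 0 0 ^+ 2 + b * (d 0 1 ^+ 2 + d 0 2%:R ^+ 2).
  have d12 : 0 <= b * (d 0 1 ^+ 2 + d 0 2%:R ^+ 2).
    by rewrite pmulr_rge0// addr_ge0 ?sqr_ge0.
  rewrite lt_neqAle addr_ge0 ?sqr_ge0// andbT.
  apply/eqP => /esym/eqP; rewrite paddr_eq0 ?sqr_ge0//.
  case/andP; rewrite (mulf_eq0 b) (gt_eqF b0)/= paddr_eq0 ?sqr_ge0//.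
  rewrite !sqrf_eq0 !mxE !subr_eq0.
  by move=> /eqP e0 /andP[/eqP e1 /eqP e2]; apply: xv; exact: row3P.
apply: (@lt_le_trans _ _ (ellipsoid a h p b x - ellipsoid a h p b v));
  last by rewrite qv subr0 Pq.
rewrite -subr_gt0 (_ : _ - _ =
  d 0 0 ^+ 2 + b * (d 0 1 ^+ 2 + d 0 2%:R ^+ 2))//.
by rewrite /d /ellipsoid !mxE; ring.
Qed.

(** * Choice of the parameters of the ellipsoid *)

Lemma finite_pos_lower_bound {R : realType} {I : finType} (r : I -> R) :
  (forall i, 0 < r i) -> exists2 d, 0 < d & forall i, d <= r i.
Proof.
(* The sum of the inverses dominates each of them; the summand 1 keeps the witness positive even for
   empty [I]. *)
move=> r0; exists (1 + \sum_i (r i)^-1)^-1 => [|i].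
  by rewrite invr_gt0 ltr_wpDr// sumr_ge0// => i _; rewrite invr_ge0 ltW.
rewrite -[leRHS]invrK lef_pV2 ?posrE ?invr_gt0//; last first.
  by rewrite ltr_wpDr// sumr_ge0// => j _; rewrite invr_ge0 ltW.
rewrite (bigD1 i)//= addrCA lerDl addr_ge0// sumr_ge0// => j _.
by rewrite invr_ge0 ltW.
Qed.

Lemma finite_pos_upper_bound {R : realType} {I : finType} (r : I -> R) :
  (forall i, 0 < r i) -> exists M, forall i, r i <= M.
Proof.
move=> r0; exists (\sum_i r i) => i.
by rewrite (bigD1 i)//= lerDl sumr_ge0// => j _; exact: ltW.
Qed.

(* The y-coordinate of the points of the ellipsoid with x-coordinate t at
   distance r from the origin. *)
Definition height {R : realType} (r1 r2 h b t r : R) : R :=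
  (b * (r ^+ 2 - t ^+ 2) + t ^+ 2 - (r1 - r2) * t - r1 * r2) / (2 * h).

Lemma height_bounds {R : realType} (d M r1 r2 : R) :
  0 < d -> d <= r1 <= M -> d <= r2 <= M ->
  exists b h, [/\ 0 < b, 0 < h & forall t r, 0 < t <= d / 2 -> d <= r <= M ->
    0 < height r1 r2 h b t r /\ t ^+ 2 + height r1 r2 h b t r ^+ 2 < r ^+ 2].
Proof.
move=> d0 /andP[dr1 r1M] /andP[dr2 r2M].
have M0 : 0 < M by lra.
(* As r^2 - t^2 >= 3 d^2 / 4, this [b] gives b (r^2 - t^2) >= 3 M^2, more than (r1 - r2) t + r1 r2
   <= 3 M^2 / 2. Then [h] is such that the numerator [N] is at most h d, so the height is at most d
   / 2 and t^2 + height^2 <= d^2 / 2 < r^2. *)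
pose b := 4 * M ^+ 2 / d ^+ 2; pose h := (b + 2) * M ^+ 2 / d.
have b0 : 0 < b by rewrite divr_gt0 ?mulr_gt0 ?exprn_gt0.
have h0 : 0 < h by rewrite divr_gt0 ?mulr_gt0 ?addr_gt0 ?exprn_gt0.
exists b, h; split=> // t r /andP[t0 td] /andP[dr rM].
pose N := b * (r ^+ 2 - t ^+ 2) + t ^+ 2 - (r1 - r2) * t - r1 * r2.
have bd : b * d ^+ 2 = 4 * M ^+ 2 by rewrite divfK// sqrf_eq0 gt_eqF.
have hd : h * d = (b + 2) * M ^+ 2 by rewrite divfK// gt_eqF.
have MM : 0 < M * M by rewrite mulr_gt0.
have r12 : r1 * r2 <= M * M by apply: ler_pM => //; lra.
have r12t : (r1 - r2) * t <= M * M / 2 by nra.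
have r12t' : - (M * M / 2) <= (r1 - r2) * t by nra.
have t2 : t ^+ 2 <= d ^+ 2 / 4 by nra.
have dM : d ^+ 2 <= M * M by nra.
have r2d : d ^+ 2 <= r ^+ 2 by nra.
have r2M' : r ^+ 2 <= M * M by nra.
have lo : b * (d ^+ 2 * (3 / 4)) <= b * (r ^+ 2 - t ^+ 2).
  by rewrite ler_pM2l//; lra.
have hi : b * (r ^+ 2 - t ^+ 2) <= b * (M * M).
  by rewrite ler_pM2l//; nra.
have N0 : 0 < N.
  have t2p : 0 <= t ^+ 2 by rewrite sqr_ge0.
  have b3 : b * (d ^+ 2 * (3 / 4)) = 3 * (M * M).
    by rewrite mulrA bd; field.
  by rewrite /N; lra.
have r12p : 0 < r1 * r2 by rewrite mulr_gt0//; lra.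
have Nh : N <= h * d by rewrite hd /N; lra.
have h20 : 0 < 2 * h by lra.
have y0 : 0 < N / (2 * h) by exact: divr_gt0.
have yd : N / (2 * h) <= d / 2.
  by rewrite ler_pdivrMr// (_ : d / 2 * (2 * h) = h * d)//; field.
split; first exact: y0.
change (t ^+ 2 + (N / (2 * h)) ^+ 2 < r ^+ 2).
have d2 : 0 < d ^+ 2 by rewrite exprn_gt0.
suff : (N / (2 * h)) ^+ 2 <= d ^+ 2 / 4 by lra.
by nra.
Qed.

(** * Placing the points *)

Lemma exists_convex_configuration {R : realType} (I : finType) (r : I -> R) :
  (4 <= #|I|)%N -> (forall i, 0 < r i) -> exists v, convex_configuration r v.
Proof.
move=> I4 r0.
have [d d0 dr] := finite_pos_lower_bound r r0.
have [M rM] := finite_pos_upper_bound r r0.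
pose e (i : I) : nat := enum_rank i.
have e_inj i j : e i = e j -> i = j by move=> /val_inj/enum_rank_inj.
have e_onto k : (k < 4)%N -> exists i, e i = k.
  move=> k4; exists (enum_val (Ordinal (leq_trans k4 I4))).
  by rewrite /e enum_valK.
have [i1 e1] := e_onto 0 isT; have [i2 e2] := e_onto 1 isT.
have [i3 e3] := e_onto 2 isT; have [i4 e4] := e_onto 3 isT.
have drM i : d <= r i <= M by rewrite dr rM.
have [b [h [b0 h0 bh]]] := height_bounds d M _ _ d0 (drM i1) (drM i2).
(* Any distinct values in the interval allowed by [height_bounds] would do. *)
pose t k : R := d / 2 / k.+1%:R.
have td k : 0 < t k <= d / 2.
  have d20 : 0 < d / 2 by lra.
  rewrite /t divr_gt0//= ler_pdivrMr// ler_peMr ?(ltW d20)//.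
  by rewrite ler1n.
have t_inj : injective t.
  move=> k l /(mulfI _) kl; have /kl/invr_inj/eqP : d / 2 != 0.
    by rewrite gt_eqF//; lra.
  by rewrite eqr_nat => /eqP[].
pose y i := height (r i1) (r i2) h b (t (e i)) (r i).
pose z i := Num.sqrt (r i ^+ 2 - t (e i) ^+ 2 - y i ^+ 2).
have y0 i : 0 < y i by have [] := bh _ _ (td (e i)) (drM i).
have z20 i : 0 < r i ^+ 2 - t (e i) ^+ 2 - y i ^+ 2.
  by have [_] := bh _ _ (td (e i)) (drM i); rewrite -/(y i); lra.
have z0 i : 0 < z i by rewrite sqrtr_gt0.
have zz i : z i ^+ 2 = r i ^+ 2 - t (e i) ^+ 2 - y i ^+ 2.
  by rewrite sqr_sqrtr// ltW.
(* Points 2 and 3 get opposite signs of z, so that the determinant required by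
   [interior_tetrahedron] is a sum of two positive products. *)
pose v i := match e i with
  | 0 => vec3 (r i) 0 0
  | 1 => vec3 (- r i) 0 0
  | 2 => vec3 (t (e i)) (y i) (- z i)
  | _ => vec3 (t (e i)) (y i) (z i)
  end.
(* The sign of z is forgotten: only its square enters the radius and the equation of the
   ellipsoid. *)
have vP i : [\/ i = i1 /\ v i = vec3 (r i) 0 0,
    i = i2 /\ v i = vec3 (- r i) 0 0 |
    exists2 s, s ^+ 2 = z i ^+ 2 & v i = vec3 (t (e i)) (y i) s].
  rewrite /v; case ei: (e i) => [|[|[|k]]].
  - by apply: Or31; split=> //; apply: e_inj; rewrite ei.
  - by apply: Or32; split=> //; apply: e_inj; rewrite ei.
  - by apply: Or33; exists (- z i); rewrite ?sqrrN.
  - by apply: Or33; exists (z i).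
have qv i : ellipsoid (r i1 - r i2) h (r i1 * r i2) b (v i) = 0.
  case: (vP i) => [[-> ->]|[-> ->]|[s sz ->]]; rewrite /ellipsoid !vec3E.
  - by ring.
  - by ring.
  - by rewrite sz zz /y /height; field; rewrite gt_eqF.
have hull_v i : convex_hull (range v) (v i) by apply: convex_hull_sub; exists i.
have v1 : v i1 = vec3 (r i1) 0 0 by rewrite /v e1.
have v2 : v i2 = vec3 (- r i2) 0 0 by rewrite /v e2.
have hull0 : convex_hull (range v) 0.
  have r12 : 0 < r i1 + r i2 by rewrite addr_gt0.
  have /convex_setP cP := convex_hull_convex (range v).
  have := cP _ _ (r i2 / (r i1 + r i2)) (r i1 / (r i1 + r i2))
    (hull_v i1) (hull_v i2).
  rewrite !divr_ge0 ?(ltW r12) ?(ltW (r0 _))// => /(_ isT isT).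
  rewrite -mulrDl addrC divff ?gt_eqF// => /(_ erefl).
  congr (convex_hull _ _); apply: row3P; rewrite v1 v2 !mxE /=;
    by field; rewrite gt_eqF.
have hull_ell x : convex_hull (range v) x ->
    ellipsoid (r i1 - r i2) h (r i1 * r i2) b x <= 0.
  apply: (smallest_sub (convex_ellipsoid _ _ _ _ (ltW b0))).
  by move=> _ [i _ <-] /=; rewrite qv.
exists v; split.
(* The two points on the x-axis differ in the sign of x; the others have y > 0 and are told apart by
   [t]. *)
- move=> i j vij.
  have vc c : v i 0 c = v j 0 c by rewrite vij.
  have := vc 0; have := vc 1.
  have ri := r0 i; have rj := r0 j; have yi := y0 i; have yj := y0 j.
  case: (vP i) => [[ii ->]|[ii ->]|[s _ ->]];
  case: (vP j) => [[jj ->]|[jj ->]|[s' _ ->]]; rewrite !vec3E.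
  + by rewrite ii jj.
  + by move=> ? ?; exfalso; clear ii jj; lra.
  + by move=> ? ?; exfalso; clear ii; lra.
  + by move=> ? ?; exfalso; clear ii jj; lra.
  + by rewrite ii jj.
  + by move=> ? ?; exfalso; clear ii; lra.
  + by move=> ? ?; exfalso; clear jj; lra.
  + by move=> ? ?; exfalso; clear jj; lra.
  + by move=> _ /t_inj/e_inj.
- move=> i; rewrite -(@ger0_norm _ (r i)) ?(ltW (r0 i))// -sqrtr_sqr /radius.
  congr Num.sqrt; rewrite dotE.
  case: (vP i) => [[_ ->]|[_ ->]|[s sz ->]]; rewrite !vec3E.
  + by ring.
  + by ring.
  + by rewrite -!expr2 sz zz; ring.
- exists (convex_hull (range v)); split=> //.
  + split.
      exists (range v) => //; exact: finite_image.
    apply: (interior_tetrahedron _ (r i1) (r i2) (t 2) (y i3) (- z i3)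
      (t 3) (y i4) (z i4)) => //.
    * exact: convex_hull_convex.
    * by rewrite mulNr opprK gt_eqF// addr_gt0// mulr_gt0.
    * by rewrite -v1.
    * by rewrite -v2.
    * by have := hull_v i3; rewrite /v e3.
    * by have := hull_v i4; rewrite /v e4.
  + by move=> i; apply: (ellipsoid_vertex _ _ _ _ _ _ b0 hull_ell).
Qed.

Theorem theorem3 (R : realType) (n k : nat) (m : 'I_k -> nat)
    (r : forall i : 'I_k, 'I_(m i) -> R)
    (n_ge4 : (4 <= n)%N)
    (m_ge1 : forall i : 'I_k, (1 <= m i)%N)
    (sum_m : (\sum_(i < k) m i)%N = n)
    (r_pos : forall (i : 'I_k) (j : 'I_(m i)), 0 < r i j)
    (r_eq : forall (i : 'I_k) (j j' : 'I_(m i)), r i j = r i j')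
    (r_decr : forall (i i' : 'I_k) (j : 'I_(m i)) (j' : 'I_(m i')),
       (i < i')%N -> r i' j' < r i j) :
  exists v : {i : 'I_k & 'I_(m i)} -> 'rV[R]_3,
    convex_configuration
      (fun p : {i : 'I_k & 'I_(m i)} => r (tag p) (tagged p)) v.
Proof.
apply: exists_convex_configuration => [|p]; last exact: r_pos.
(* The index pairs number m_1 + ... + m_k = n. *)
rewrite card_tagged sumnE big_map big_enum /=.
by under eq_bigr do rewrite card_ord; rewrite sum_m.
Qed.
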